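(* Let $h$ and $k$ be positive integers such that $3 \leq h \leq k - 1$ and $k \geq 5$. Let $A = \{a_1, a_2, \ldots, a_k\}$ be a set of nonnegative integers such that $0 = a_1 < a_2 < \cdots < a_k$. Then \[|h^{\wedge}_{\pm}A| \geq 2hk - h(h + 1) + 1.\] This lower bound is best possible.
   Context: For a nonempty finite set $A=\{a_1,\ldots,a_k\}$ of integers and a positive integer $h$, the restricted $h$-fold signed sumset of $A$ is \[h^{\wedge}_{\pm}A=\left\{ \sum_{i=1}^{k} \lambda_{i} a_{i}: \lambda_{i} \in \{ -1, 0, 1\} \text{ for } i=1,\ldots,k \text{ and } \sum_{i=1}^{k} |\lambda_{i}| =h\right\}.\] *)

(* Defs.v *)
From HB Require Import structures.
From mathcomp Require Import all_boot all_order all_algebra.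
From mathcomp Require Import finmap.

Set Implicit Arguments.
Unset Strict Implicit.
Unset Printing Implicit Defensive.

Import Order.TTheory GRing.Theory Num.Theory.

Local Open Scope ring_scope.
Local Open Scope fset_scope.

Definition signs : {fset int} := [fset -1; 0; 1].

(* The coefficient vectors (lambda_i) are the finite functions A -> signs, where
   the finite sets A and signs are coerced to the finTypes of their elements;
   [val] is the inclusion into int. *)
Definition signed_weight (A : {fset int}) (lam : {ffun A -> signs}) : int :=
  \sum_(a : A) `|val (lam a)|.

Definition signed_sum (A : {fset int}) (lam : {ffun A -> signs}) : int :=
  \sum_(a : A) val (lam a) * val a.

Definition restricted_signed_sumset (h : nat) (A : {fset int}) : {fset int} :=
  [fset signed_sum lam |
     lam in [pred lam : {ffun A -> signs} | signed_weight lam == h%:Z]].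

Lemma restricted_signed_sumsetP (h : nat) (A : {fset int}) (x : int) :
  reflect (exists lam : {ffun A -> signs},
             \sum_(a : A) `|val (lam a)| = h%:Z
             /\ x = \sum_(a : A) val (lam a) * val a)
          (x \in restricted_signed_sumset h A).
Proof.
apply: (iffP idP) => [/imfsetP [lam /eqP hlam ->]|[lam [hlam ->]]].
  by exists lam.
by apply/imfsetP; exists lam => //; apply/eqP.
Qed.

(* A = {a_1, ..., a_k} is a set of nonnegative integers with
   0 = a_1 < a_2 < ... < a_k; here (a i) is a_(i+1). *)
Definition nonneg_set_from_zero (k : nat) (A : {fset int}) : Prop :=
  exists a : 'I_k -> int,
    [/\ A = [fset a i | i : 'I_k],
        forall i : 'I_k, 0 <= a i,
        forall i : 'I_k, i = 0%N :> nat -> a i = 0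
      & forall i j : 'I_k, (i < j)%N -> a i < a j].

(* Main.v *)
Require Import Defs.
From mathcomp Require Import all_boot all_order all_algebra.
From mathcomp Require Import finmap.
From mathcomp Require Import zify.
From Stdlib Require Classical_Prop.

(* Adjoining a new maximum b to A' adds 2h sums: if T is an h-subset of A' of
   maximal sum, all old sums lie in [-sum T, sum T], while b + sum T - t and its
   opposite, for t in T, are new.  This reduces the lower bound to k = h + 1.
   There a signed sum omits exactly one a in A, hence equals sum A - d with
   d = a + 2 sum S, S a subset of A \ {a}, and m^2 + m + 1 values of d are needed,
   where m = h = |A| - 1.  After dividing by a power of 2, A has an odd element;
   write s + 1 for the number of even elements of A (0 included) and r = m - s
   for the number of odd ones.  For the even a, with maximum p, the chain
      a < p;   p + 2 sum S, S in A \ {p};   2 sum A - a, a < p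
   has m(m-1)/2 + 2s + 1 terms, and for the odd a the analogous chain has
   m(m-1)/2 + 2r - 1.  If 2s < m, the sums 2 sum S are more numerous than the
   even chain, and the total suffices.  Otherwise the chains give m^2 + m, one
   short, and if neither class has a further value then the initial values are
   exactly those of the chain.  This forces the even elements to be
   0, 2q, ..., 2sq with q the least positive element, q odd, and then a shift by q
   injects the nonzero even elements into the odd ones other than the largest,
   against s >= r; the one exception is A = {0, q, 2q, 4q}, for which the 20 sums
   needed after adjoining b > 4q are explicit (19 are required).
   For A = {0, ..., k-1} all sums lie in an interval of the required length. *)

Import Order.TTheory GRing.Theory Num.Theory.

Local Open Scope fset_scope.
Local Open Scope ring_scope.

(** * Counting values and summing elements of finite sets of integers *)

Definition fsum (S : {fset int}) : int := \sum_(x <- S) x.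

(** A finite set of witnesses certifies the count, so the set of all values of [X] never has to be
    formed and [X] may be undecidable. *)
Definition atleast (n : nat) (X : int -> Prop) : Prop :=
  exists2 F : {fset int}, (n <= #|` F|)%N & forall x, x \in F -> X x.

Definition nonneg (A : {fset int}) : Prop := forall a, a \in A -> 0 <= a.

Lemma atleast_imp (n n' : nat) (X Y : int -> Prop) :
  (n' <= n)%N -> (forall x, X x -> Y x) -> atleast n X -> atleast n' Y.
Proof.
move=> le XY [F cF FX]; exists F; first exact: leq_trans cF.
by move=> x /FX /XY.
Qed.

Lemma atleastU (n n' : nat) (X Y Z : int -> Prop) :
  (forall x, X x -> Z x) -> (forall x, Y x -> Z x) ->
  (forall x, X x -> Y x -> False) ->
  atleast n X -> atleast n' Y -> atleast (n + n') Z.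
Proof.
move=> XZ YZ XY [F cF FX] [G cG GY]; exists (F `|` G).
  have FG0 : F `&` G = fset0.
    apply/fsetP => x; rewrite in_fsetI in_fset0; apply/negP => /andP[/FX Xx /GY Yx].
    exact: XY Xx Yx.
  by have := cardfsUI F G; rewrite FG0 cardfs0; lia.
by move=> x; rewrite in_fsetU => /orP[/FX/XZ|/GY/YZ].
Qed.

Lemma card_image_int (f : int -> int) (A : {fset int}) :
  injective f -> #|` f @` A| = #|` A|.
Proof. by move=> injf; rewrite card_imfset. Qed.

Lemma atleast_image (F : {fset int}) (f : int -> int) (X : int -> Prop) :
  injective f -> (forall x, x \in F -> X (f x)) -> atleast #|` F| X.
Proof.
move=> injf FX; exists (f @` F); first by rewrite card_imfset.
by move=> _ /imfsetP[x /= xF ->]; exact: FX.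
Qed.

Lemma atleast_inj (n : nat) (f : int -> int) (X Y : int -> Prop) :
  injective f -> (forall x, X x -> Y (f x)) -> atleast n X -> atleast n Y.
Proof.
move=> injf XY [F cF FX]; apply: (atleast_imp #|` F| n Y) => //.
by apply: (atleast_image F f) => // x /FX /XY.
Qed.

(** The function [f] lets the same argument give maxima, minima (through negation) and a subset of
    largest sum. *)
Lemma fset_max {K : choiceType} (f : K -> int) (F : {fset K}) :
  F != fset0 -> exists2 x, x \in F & forall y, y \in F -> f y <= f x.
Proof.
elim/finSet_rect: F => F IH /fset0Pn[x xF].
case: (eqVneq (F `\ x) fset0) => [F0|/(IH _ (fproperD1 xF))[y yF ymax]].
  exists x => // z zF; case: (eqVneq z x) => [->|zx] //.
  by have := in_fset0 z; rewrite -F0 in_fsetD1 zx zF.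
have [yx yF'] : y != x /\ y \in F by move: yF; rewrite !inE => /andP[].
case: (leP (f x) (f y)) => fxy.
  exists y => // z zF; case: (eqVneq z x) => [->|zx] //.
  by apply: ymax; rewrite !inE zx zF.
exists x => // z zF; case: (eqVneq z x) => [->|zx] //.
apply: le_trans (ltW fxy); apply: ymax; by rewrite !inE zx zF.
Qed.

Lemma fsum0 : fsum fset0 = 0.
Proof. by rewrite /fsum big_seq_fset0. Qed.

Lemma fsum1 (x : int) : fsum [fset x] = x.
Proof. by rewrite /fsum big_seq_fset1. Qed.

Lemma fsumD1 (A : {fset int}) (x : int) :
  x \in A -> fsum A = x + fsum (A `\ x).
Proof. by move=> xA; rewrite /fsum (big_fsetD1 x). Qed.

Lemma fsumU1 (A : {fset int}) (x : int) :
  x \notin A -> fsum (x |` A) = x + fsum A.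
Proof. by move=> xA; rewrite /fsum big_fsetU1. Qed.

Lemma sum_fsetU (F : int -> int) (S T : {fset int}) :
  [disjoint S & T] ->
  \sum_(x <- S `|` T) F x = \sum_(x <- S) F x + \sum_(x <- T) F x.
Proof.
move=> dST; rewrite (big_fsetID _ (mem S)) /=; congr (_ + _).
  by apply: eq_fbigl => x; rewrite !inE /=; case: (x \in S); rewrite ?andbF.
apply: eq_fbigl => x; rewrite !inE /=; case xS: (x \in S); rewrite /= ?andbF ?andbT //.
by apply/esym/negbTE; move/fdisjointP: dST; apply.
Qed.

Lemma fsumU (S T : {fset int}) :
  [disjoint S & T] -> fsum (S `|` T) = fsum S + fsum T.
Proof. exact: sum_fsetU. Qed.

Lemma nonnegS (S A : {fset int}) : S `<=` A -> nonneg A -> nonneg S.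
Proof. by move=> /fsubsetP SA nA x /SA /nA. Qed.

Lemma fsum_ge0 (A : {fset int}) : nonneg A -> 0 <= fsum A.
Proof.
by move=> nA; rewrite /fsum big_seq_cond; apply: sumr_ge0 => x /andP[/nA].
Qed.

Lemma fsum_sub (S A : {fset int}) : nonneg A -> S `<=` A -> fsum S <= fsum A.
Proof.
move=> nA SA.
have dis : [disjoint S & A `\` S] by apply/fdisjointP => x xS; rewrite !inE xS.
have -> : A = S `|` (A `\` S) by rewrite fsetUDl fsetDv fsetD0; apply/esym/fsetUidPr.
rewrite fsumU // lerDl; apply: fsum_ge0; apply: nonnegS nA; exact: fsubsetDl.
Qed.

(** Induction by removing the maximum M: the old sums are at most fsum G - M, while fsum G and fsum
    G - x, for the other x in G, lie strictly above. *)
Lemma subset_sums (n : nat) (G : {fset int}) :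
  (forall g, g \in G -> 0 < g) -> #|` G| = n ->
  exists2 c : nat, (n * n + n + 2 = 2 * c)%N &
    atleast c (fun x => exists2 S, S `<=` G & x = fsum S).
Proof.
elim: n G => [|n IH] G Gpos cG.
  exists 1%N => //; exists [fset 0]; first by rewrite cardfs1.
  by move=> x; rewrite inE => /eqP->; exists fset0; rewrite ?fsub0set ?fsum0.
have /(fset_max id)[M MG Mmax] : G != fset0 by rewrite -cardfs_gt0 cG.
have nG : nonneg G by move=> g /Gpos/ltW.
have cG' : #|` G `\ M| = n by have := cardfsD1 M G; rewrite MG; lia.
have sG' : G `\ M `<=` G by exact: fsubD1set.
have [|c cE cat] := IH _ _ cG'.
  by move=> g; rewrite !inE => /andP[_ /Gpos].
exists (c + n.+1)%N; first by lia.
pose Y x := (exists2 S, S `<=` G & x = fsum S) /\ fsum (G `\ M) < x.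
apply: (atleastU c n.+1 (fun x => exists2 S, S `<=` G `\ M & x = fsum S) Y) => //.
- by move=> x [S SG ->]; exists S => //; apply: fsubset_trans sG'.
- by move=> x [].
- by move=> x [S SG ->] [_]; have := fsum_sub _ _ (nonnegS _ _ sG' nG) SG; lia.
(* The added 0 stands for removing nothing, that is, for the full sum. *)
have -> : n.+1 = #|` 0 |` (G `\ M)|.
  rewrite cardfsU1 cG' (_ : 0 \notin _) //; apply/negP.
  by rewrite !inE => /andP[_ /Gpos].
apply: (atleast_image _ (fun x => fsum G - x)); first by move=> x y; lia.
move=> x; rewrite !inE => /orP[/eqP->|/andP[xM xG]].
  split; last by rewrite (fsumD1 G M MG); have := Gpos _ MG; lia.
  by exists G; rewrite ?subr0.
split; last first.
  by rewrite (fsumD1 G M MG); have := Mmax _ xG; move: xM => /eqP /=; lia.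
by exists (G `\ x); rewrite ?fsubD1set // (fsumD1 G x xG); lia.
Qed.

(** * Omission sums and the chains of their values *)

(* The values d above, with the omitted element a restricted to P. *)
Definition omission_sum (A P : {fset int}) (x : int) : Prop :=
  exists a S, [/\ a \in P, S `<=` A `\ a & x = a + 2 * fsum S].

Lemma omission_sum0 (A P : {fset int}) (a : int) :
  a \in P -> omission_sum A P a.
Proof. by move=> aP; exists a, fset0; rewrite fsub0set fsum0; split=> //; lia. Qed.

Lemma omission_sum1 (A P : {fset int}) (a b : int) :
  a \in P -> b \in A -> b != a -> omission_sum A P (a + 2 * b).
Proof.
move=> aP bA ba; exists a, [fset b]; split=> //; last by rewrite fsum1.
by rewrite fsub1set !inE ba.
Qed.

(** Three disjoint ranges are counted: [L] up to p + 2M; p + 2(M + x), with x a positive subset sum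
    of A without 0, p, M; and, above p + 2 fsum (A \ p), the values 2 fsum A - x = x + 2 fsum (A \
    x) for x in P below p. The initial range is a parameter so that an extra value can be inserted
    there. *)
Lemma omission_sum_chain (n : nat) (A P L : {fset int}) (p M : int) :
  nonneg A -> 0 \in A -> P `<=` A -> #|` A| = n.+3 ->
  p \in P -> (forall x, x \in P -> x <= p) -> 0 < p ->
  M \in A `\ p -> (forall x, x \in A `\ p -> x <= M) ->
  (forall x, x \in L -> omission_sum A P x /\ x <= p + 2 * M) ->
  exists2 c : nat, (2 * c = n * n + n)%N &
    atleast (#|` L| + c + (#|` P| - 1)) (omission_sum A P).
Proof.
move=> nA A0 PA cA pP pmax p0 MAp Mmax HL.
have pA : p \in A by exact: (fsubsetP PA).
have M0 : M != 0.
  apply/eqP => M0.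
  have : A `<=` [fset (0 : int); p].
    apply/fsubsetP => x xA; rewrite !inE; case: (eqVneq x p) => [->|xp]; rewrite ?orbT ?orbF //.
    have /Mmax : x \in A `\ p by rewrite !inE xp.
    by have := nA _ xA; lia.
  by move/fsubset_leq_card; rewrite cardfs2 cA; lia.
pose G := A `\ p `\ M `\ (0 : int).
have sGp : G `<=` A `\ p by apply: fsubset_trans (fsubD1set _ _) (fsubD1set _ _).
have Gpos g : g \in G -> 0 < g.
  rewrite !inE => /and4P[g0 _ _ /nA]; lia.
have cG : #|` G| = n.
  have := cardfsD1 p A; have := cardfsD1 M (A `\ p); have := cardfsD1 (0 : int) (A `\ p `\ M).
  have -> : 0 \in A `\ p `\ M.
    by rewrite !inE A0 (eq_sym 0 M) M0 andbT; apply/eqP; lia.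
  by rewrite pA MAp cA -/G; lia.
have [c cE [F cF FG]] := subset_sums n G Gpos cG.
(* The empty subset of [G] would give p + 2M, which belongs to the first range. *)
exists c.-1; first by lia.
set T := fsum (A `\ p).
have nAp : nonneg (A `\ p) by apply: nonnegS nA; exact: fsubD1set.
pose X2 x := omission_sum A P x /\ p + 2 * M < x <= p + 2 * T.
have at2 : atleast c.-1 X2.
  apply: (atleast_imp #|` F `\ (0 : int)| _ X2) => //.
    by have := cardfsD1 (0 : int) F; case: (0 \in F); lia.
  apply: (atleast_image _ (fun x => p + 2 * (M + x))); first by move=> x y; lia.
  move=> x; rewrite !inE => /andP[x0 /FG[S SG xS]].
  have nS : nonneg S by move=> g /(fsubsetP SG) /Gpos/ltW.
  have MS : M \notin S.
    by apply/negP => /(fsubsetP SG); rewrite !inE eqxx andbF.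
  have sub : M |` S `<=` A `\ p.
    by rewrite fsubUset fsub1set MAp; exact: fsubset_trans sGp.
  split; first by exists p, (M |` S); split=> //; rewrite fsumU1 // xS.
  have := fsum_ge0 _ nS; have := fsum_sub _ _ nAp sub; rewrite fsumU1 //.
  by rewrite -/T -xS; move/eqP: x0; lia.
have TA : fsum A = p + T by exact: fsumD1.
pose X3 x := omission_sum A P x /\ p + 2 * T < x.
have at3 : atleast (#|` P| - 1) X3.
  apply: (atleast_imp #|` P `\ p| _ X3) => //.
    by have := cardfsD1 p P; rewrite pP; lia.
  apply: (atleast_image _ (fun x => 2 * fsum A - x)); first by move=> x y; lia.
  move=> x; rewrite !inE => /andP[/eqP xp xP].
  split; last by have := pmax _ xP; lia.
  exists x, (A `\ x); split=> //.
  by rewrite (fsumD1 A x); [lia|exact: (fsubsetP PA)].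
pose X1 x := omission_sum A P x /\ x <= p + 2 * M.
have at1 : atleast #|` L| X1 by exists L.
have MT : M <= T.
  by rewrite -(fsum1 M); apply: fsum_sub => //; rewrite fsub1set.
apply: (atleastU _ _ (fun x => omission_sum A P x /\ x <= p + 2 * T) X3) at3; last first.
  apply: (atleastU _ _ X1 X2) at1 at2.
  - by move=> x [? ?]; split=> //; lia.
  - by move=> x [? ?]; split=> //; lia.
  - by move=> x [_ ?] [_ ?]; lia.
- by move=> x [_ ?] [_ ?]; lia.
- by move=> x [].
- by move=> x [].
Qed.

(* In the last alternative no omission sum up to p + 2 M lies off the chain; an
   extra one would add 1 to the count. *)
Lemma omission_sum_bound (n : nat) (A P : {fset int}) (p M : int) :
  nonneg A -> 0 \in A -> P `<=` A -> #|` A| = n.+3 ->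
  p \in P -> (forall x, x \in P -> x <= p) -> 0 < p ->
  M \in A `\ p -> (forall x, x \in A `\ p -> x <= M) ->
  exists2 c : nat, (2 * c = n * n + n)%N &
    atleast (2 * (#|` P| - 1) + n.+2 + c) (omission_sum A P) /\
    (atleast (2 * (#|` P| - 1) + n.+2 + c).+1 (omission_sum A P) \/
     forall u, omission_sum A P u -> u <= p + 2 * M ->
       u \in P \/ exists2 g, g \in A `\ p & u = p + 2 * g).
Proof.
move=> nA A0 PA cA pP pmax p0 MAp Mmax.
have pA : p \in A by exact: (fsubsetP PA).
have nAp : nonneg (A `\ p) by apply: nonnegS nA; exact: fsubD1set.
have M0 : 0 <= M by exact: nAp.
pose I : {fset int} := (fun g : int => p + 2 * g) @` (A `\ p).
have cI : #|` I| = #|` A `\ p| by apply: card_image_int => x y; lia.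
(* Initial part of the chain: |P| - 1 values below p, then n + 2 values from p on, the first of them
   p itself from g = 0. *)
pose L : {fset int} := (P `\ p) `|` I.
have LP x : x \in L -> omission_sum A P x /\ x <= p + 2 * M.
  rewrite in_fsetU => /orP[|/imfsetP[g /= gA ->]].
    rewrite !inE => /andP[_ xP]; split; first exact: omission_sum0.
    by have := pmax _ xP; lia.
  split; last by have := Mmax _ gA; lia.
  by move: gA; rewrite !inE => /andP[gp gA]; exact: omission_sum1.
have cL : #|` L| = (#|` P| - 1 + n.+2)%N.
  have L0 : (P `\ p) `&` I = fset0.
    apply/fsetP => x; rewrite in_fsetI in_fset0; apply/negP => /andP[].
    rewrite !inE => /andP[xp xP] /imfsetP[g /= /nAp g0 xE].
    by have := pmax _ xP; move/eqP: xp; lia.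
  have := cardfsUI (P `\ p) I; rewrite L0 cardfs0 -/L cI.
  by have := cardfsD1 p A; have := cardfsD1 p P; rewrite pA pP; lia.
have [c cE Hc] := omission_sum_chain _ _ _ _ _ _ nA A0 PA cA pP pmax p0 MAp Mmax LP.
exists c => //; split; first by apply: atleast_imp Hc; [lia|].
set B := atleast _.+1 _.
suff extra u : omission_sum A P u -> u <= p + 2 * M -> u \notin L -> B.
  case: (Classical_Prop.classic B) => [?|nB]; [by left|right] => u Uu uM.
  case: (boolP (u \in L)) => [|/(extra _ Uu uM) //].
  rewrite in_fsetU => /orP[|/imfsetP[g /= gA ->]]; last by right; exists g.
  by rewrite !inE => /andP[_ ?]; left.
(* The chain is counted again with [u] inserted into its initial part. *)
move=> Uu uM uL.
have LP' x : x \in u |` L -> omission_sum A P x /\ x <= p + 2 * M.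
  by rewrite in_fsetU in_fset1 => /orP[/eqP->|/LP].
have [c' cE' Hc'] := omission_sum_chain _ _ _ _ _ _ nA A0 PA cA pP pmax p0 MAp Mmax LP'.
apply: atleast_imp Hc' => //.
by rewrite cardfsU1 uL cL; lia.
Qed.

(** * Structure of the sets whose even and odd chains miss no value *)

Lemma fset_min (F : {fset int}) :
  F != fset0 -> exists2 x, x \in F & forall y, y \in F -> x <= y.
Proof.
move=> /(fset_max (fun x : int => - x))[x xF xmin].
by exists x => // y /xmin; lia.
Qed.

(** Pigeonhole: an injection into a set that is no larger is onto. For translations of the even
    elements this supplies predecessors. *)
Lemma image_eq (f : int -> int) (B C : {fset int}) :
  injective f -> (forall x, x \in B -> f x \in C) -> (#|` C| <= #|` B|)%N ->
  forall y, y \in C -> exists2 x, x \in B & y = f x.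
Proof.
move=> injf fBC cCB y yC.
have /eqP E : f @` B == C.
  rewrite eqEfcard card_image_int // cCB andbT.
  by apply/fsubsetP => _ /imfsetP[x /= xB ->]; exact: fBC.
by move: yC; rewrite -E => /imfsetP[x /= xB ->]; exists x.
Qed.

(* [zify] also translates membership and quantified hypotheses, which makes [lia]
   impractically slow; they are cleared first. *)
Ltac arith := repeat match goal with
  | H : is_true (in_mem _ (@mem _ (finSetPredType _) _)) |- _ => clear H
  | H : forall _, _ |- _ => clear H
  end; lia.

Section TightStructure.

(** [P] and [Q] are the even and odd classes. With |P| = s + 1 and m = n + 2, [cP] reads 2s >= m.
    The hypotheses [tightP] and [tightQ] express tightness for the sums a + 2b, where S is a
    singleton. *)
Variables (n : nat) (A P Q : {fset int}) (p M o N : int).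
Hypotheses (nA : nonneg A) (A0 : 0 \in A) (n_gt0 : (0 < n)%N).
Hypotheses (PE : forall x, (x \in P) = (x \in A) && (2 %| x)%Z).
Hypotheses (QE : forall x, (x \in Q) = (x \in A) && ~~ (2 %| x)%Z).
Hypotheses (cPQ : (#|` P| + #|` Q| = n.+3)%N).
Hypotheses (cP : (n + 4 <= 2 * #|` P|)%N).
Hypotheses (pP : p \in P) (p_max : forall x, x \in P -> x <= p).
Hypotheses (oQ : o \in Q) (o_max : forall x, x \in Q -> x <= o).
Hypothesis (M_max : forall x, x \in A -> x != p -> x <= M).
Hypothesis (N_max : forall x, x \in A -> x != o -> x <= N).
Hypothesis tightP : forall a b, a \in P -> b \in A -> b != a ->
  a + 2 * b <= p + 2 * M ->
  a + 2 * b \in P \/ exists g, [/\ g \in A, g != p & a + 2 * b = p + 2 * g].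
Hypothesis tightQ : forall a b, a \in Q -> b \in A -> b != a ->
  a + 2 * b <= o + 2 * N ->
  a + 2 * b \in Q \/ exists g, [/\ g \in A, g != o & a + 2 * b = o + 2 * g].

Let P0 : (0 : int) \in P.
Proof. by rewrite PE A0; arith. Qed.

Let PA x : x \in P -> x \in A.
Proof. by rewrite PE => /andP[]. Qed.

Let QA x : x \in Q -> x \in A.
Proof. by rewrite QE => /andP[]. Qed.

Let Pev x : x \in P -> (2 %| x)%Z.
Proof. by rewrite PE => /andP[]. Qed.

Let Qodd x : x \in Q -> ~~ (2 %| x)%Z.
Proof. by rewrite QE => /andP[]. Qed.

(** If e were even, translation by 2e would map P without p, e onto P without 0, e, so p = f + 2e
    with f in P. Let o1 be the least odd element. For f nonzero, the sum f + 2 o1 > p forces the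
    smaller odd element o1 - e into A. For f = 0, p = 2e; then e + 2 o1 forces o1 = 3e/2, and 2 o1
    forces e/2 into A, below e. *)
Lemma tight_min_odd (e : int) :
  e \in A -> 0 < e -> (forall x, x \in A -> x = 0 \/ e <= x) -> ~~ (2 %| e)%Z.
Proof.
move=> eA e0 emin; apply/negP => ev_e.
have eP : e \in P by rewrite PE eA.
have [o1 o1Q o1min] : exists2 x, x \in Q & forall y, y \in Q -> x <= y.
  by apply: fset_min; apply/fset0Pn; exists o.
have o1A := QA _ o1Q.
have o1odd := Qodd _ o1Q.
have pe : e != p.
  apply/eqP => ep; have : P `<=` [fset (0 : int); p].
    apply/fsubsetP => x xP; rewrite !inE.
    by case: (emin _ (PA _ xP)) (p_max _ xP); arith.
  by move/fsubset_leq_card; rewrite cardfs2; arith.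
have ev_p := Pev _ pP.
have op : o1 != p by arith.
have o1M := M_max _ o1A op.
have eM := M_max _ eA pe.
have eo1 : e < o1 by case: (emin _ o1A); arith.
(* As f < p, the form p + 2g is too large for g >= e; so g = 0 and the sum is p, again in P. *)
have Pstep f : f \in P -> f != p -> f != e -> f + 2 * e \in P.
  move=> fP fp fe; have lefp := p_max _ fP.
  case: (tightP f e fP eA) => //; [by rewrite eq_sym|arith|].
  move=> [g [gA gp E]]; case: (emin _ gA) => g0; last by arith.
  by have -> : f + 2 * e = p by arith.
have Ppred y : y \in P `\ (0 : int) `\ e ->
    exists2 x, x \in P `\ p `\ e & y = x + 2 * e.
  apply: image_eq; first by move=> x z; arith.
    move=> x; rewrite !in_fsetD1 => /and3P[xe xp xP]; rewrite Pstep //.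
    by have := nA _ (PA _ xP); arith.
  have := cardfsD1 (0 : int) P; have := cardfsD1 e (P `\ (0 : int)).
  have := cardfsD1 p P; have := cardfsD1 e (P `\ p).
  by rewrite !in_fsetD1 P0 pP eP pe (_ : e != 0) //; arith.
have p0 : p != 0 by have := p_max _ eP; arith.
have [|f] := Ppred p; first by rewrite !in_fsetD1 pP p0 eq_sym pe.
rewrite !in_fsetD1 => /and3P[fe fp fP] pE.
have ev_f := Pev _ fP.
case: (eqVneq f 0) => [f0|f0]; last first.
  case: (tightP f o1 fP o1A); [arith|arith| |].
    by move=> /p_max; arith.
  move=> [g [gA gp E]].
  have : g \in Q by rewrite QE gA; arith.
  by move=> /o1min; arith.
case: (tightP e o1 eP o1A); [arith|arith| |].
  by move=> /p_max; arith.
move=> [g [gA gp E]].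
have gP : g \in P.
  rewrite PE gA; case: (boolP (2 %| g)%Z) => // godd.
  by have : g \in Q; [rewrite QE gA|move=> /o1min; arith].
have ge : g = e.
  apply/eqP; apply: contraT => ge.
  case: (eqVneq g 0) => g0; first by arith.
  have [|x] := Ppred g; first by rewrite !in_fsetD1 gP g0 ge.
  rewrite !in_fsetD1 => /and3P[_ _ /PA/nA] x0.
  by have := p_max _ gP; arith.
case: (tightP 0 o1 P0 o1A); [arith|arith| |].
  by move=> /p_max; arith.
move=> [g' [g'A g'p E']].
by case: (emin _ g'A); arith.
Qed.

(** Tightness of the even chain makes P an arithmetic progression of step 2q from 0. A single odd
    element then leaves only n = 1; with two or more, the odd chain yields the shift by q and a
    contradiction in cardinality. *)
Lemma tight_structure :
  n = 1%N /\ exists q, [/\ 0 < q, q \in A, 2 * q \in A & 4 * q \in A].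
Proof.
have [q] : exists2 x, x \in A `\ (0 : int) & forall y, y \in A `\ (0 : int) -> x <= y.
  apply: fset_min; apply/fset0Pn; exists o.
  by rewrite in_fsetD1 QA // andbT; have := Qodd _ oQ; arith.
rewrite in_fsetD1 => /andP[q0 qA] qmin'.
have qpos : 0 < q by have := nA _ qA; arith.
have qmin x : x \in A -> x = 0 \/ q <= x.
  move=> xA; case: (eqVneq x 0) => [->|x0]; [by left|right].
  by apply: qmin'; rewrite in_fsetD1 x0.
have odd_q := tight_min_odd _ qA qpos qmin.
have qQ : q \in Q by rewrite QE qA.
have ev_p := Pev _ pP.
have qp : q != p by arith.
have qM := M_max _ qA qp.
have Pstep f : f \in P -> f != p -> f + 2 * q \in P.
  move=> fP fp; have lefp := p_max _ fP; have ev_f := Pev _ fP.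
  case: (tightP f q fP qA) => //; [arith|arith|].
  move=> [g [gA gp E]]; case: (qmin _ gA) => g0; last by arith.
  by have -> : f + 2 * q = p by arith.
have cP0 : #|` P `\ (0 : int)| = (#|` P| - 1)%N.
  by have := cardfsD1 (0 : int) P; rewrite P0; arith.
have Pshift y : y \in P `\ (0 : int) -> exists2 x, x \in P `\ p & y = x + 2 * q.
  apply: image_eq; first by move=> x z; arith.
    move=> x; rewrite !in_fsetD1 => /andP[xp xP]; rewrite Pstep //.
    by have := nA _ (PA _ xP); arith.
  by rewrite cP0; have := cardfsD1 p P; rewrite pP; arith.
have Ppred y : y \in P -> y != 0 -> y - 2 * q \in P.
  move=> yP y0; have [|x] := Pshift y; first by rewrite in_fsetD1 y0.
  rewrite in_fsetD1 => /andP[xp xP] ->.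
  by have -> : x + 2 * q - 2 * q = x by arith.
(* Descent by 2q inside P, cut off after three steps. *)
have Psmall x : x \in P -> [\/ x = 0, x = 2 * q, x = 4 * q | 6 * q <= x].
  move=> xP; case: (eqVneq x 0) => [|x0]; first by constructor 1.
  have x1 := Ppred _ xP x0.
  case: (eqVneq x (2 * q)) => [|x2]; first by constructor 2.
  have x3 : x - 2 * q - 2 * q \in P by apply: Ppred => //; arith.
  case: (eqVneq x (4 * q)) => [|x4]; first by constructor 3.
  have /PA/nA x5 : x - 2 * q - 2 * q - 2 * q \in P by apply: Ppred => //; arith.
  by constructor 4; arith.
have pq : 4 * q <= p.
  case: (leP (4 * q) p) => // p4.
  have : P `<=` [fset (0 : int); 2 * q].
    apply/fsubsetP => x xP; rewrite !inE.
    by case: (Psmall _ xP) (p_max _ xP); arith.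
  by move/fsubset_leq_card; rewrite cardfs2; arith.
have P2 : 2 * q \in P by rewrite -(add0r (2 * q)); apply: Pstep; rewrite ?P0 //; arith.
have P4 : 4 * q \in P.
  have -> : 4 * q = 2 * q + 2 * q by arith.
  by apply: Pstep => //; arith.
case: (eqVneq o q) => oq.
  have Qq x : x \in Q -> x = q.
    by move=> xQ; case: (qmin _ (QA _ xQ)) (o_max _ xQ) (Qodd _ xQ); arith.
  have cQ : #|` Q| = 1%N.
    have -> : Q = [fset q]; last by rewrite cardfs1.
    apply/fsetP => x; rewrite inE; apply/idP/eqP; [exact: Qq|by move->].
  case: (eqVneq n 1%N) => [|n1].
    by split=> //; exists q; split=> //; exact: PA.
  have p6 : 6 * q <= p.
    case: (Psmall _ pP); [arith|arith| |by []] => p4.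
    have : P `<=` [fset (0 : int); 2 * q] `|` [fset p].
      apply/fsubsetP => x xP; rewrite !inE.
      by case: (Psmall _ xP) (p_max _ xP); arith.
    move/fsubset_leq_card; have := cardfsUI [fset (0 : int); 2 * q] [fset p].
    by rewrite cardfs2 cardfs1; arith.
  have M4 : 4 * q <= M by apply: M_max; [exact: PA|arith].
  (* The value p + 6q exceeds p, so tightness demands the odd element g = 3q, although Q = {q}. Two
     representations are given since p - 2q and 4q coincide when p = 6q. *)
  have [a [b [aP bP ba abE]]] :
      exists a b, [/\ a \in P, b \in P, b != a & a + 2 * b = p + 6 * q].
    case: (eqVneq p (6 * q)) => [p6E|p6n].
      by exists 0, p; split=> //; arith.
    exists (p - 2 * q), (4 * q); split=> //; [apply: Ppred => //|..]; arith.
  case: (tightP a b aP (PA _ bP) ba); first by arith.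
    by move=> /p_max; arith.
  move=> [g [gA gp E]].
  have : g \in Q by rewrite QE gA; arith.
  by move=> /Qq; arith.
have [o'] : exists2 x, x \in Q `\ o & forall y, y \in Q `\ o -> y <= x.
  apply: (fset_max id); apply/fset0Pn; exists q.
  by rewrite in_fsetD1 qQ eq_sym oq.
rewrite in_fsetD1 => /andP[o'o o'Q] o'max'.
have o'max x : x \in Q -> x = o \/ x <= o'.
  move=> xQ; case: (eqVneq x o) => [->|xo]; [by left|right].
  by apply: o'max'; rewrite in_fsetD1 xo.
have leo := o_max _ o'Q.
have odd_o := Qodd _ oQ.
have odd_o' := Qodd _ o'Q.
have qo := o_max _ qQ.
have NP x : x \in P -> x <= N.
  by move=> xP; apply: N_max; [exact: PA|have := Pev _ xP; arith].
have qN : q <= N by apply: N_max => //; rewrite eq_sym.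
have N4 := NP _ P4.
(* Here [o'] is the second largest odd element. If it is not q, the sum o' + 2q decides. If it is q,
   the sum q + 4q leaves o = 3q or 5q, and q + 2o excludes 5q, since it would require 3q in Q. *)
have oE : o = o' + 2 * q.
  case: (eqVneq o' q) => [o'q|o'q]; last first.
    case: (tightQ o' q o'Q qA); [by rewrite eq_sym|arith| |].
      by move=> /o'max; arith.
    by move=> [g [gA go E]]; case: (qmin _ gA); arith.
  have o35 : o = 3 * q \/ o = 5 * q.
    case: (tightQ q (2 * q) qQ (PA _ P2)); [arith|arith| |].
      by move=> /o'max; arith.
    move=> [g [gA go E]]; case: (boolP (2 %| g)%Z) => ev_g.
      have gP : g \in P by rewrite PE gA.
      by case: (Psmall _ gP); arith.
    have gQ : g \in Q by rewrite QE gA.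
    by case: (qmin _ gA) (o'max _ gQ); arith.
  case: o35 => [|o5]; first by arith.
  case: (tightQ q o qQ (QA _ oQ)); [arith|arith| |].
    by move=> /o'max; arith.
  move=> [g [gA go E]].
  have gQ : g \in Q by rewrite QE gA; arith.
  by case: (o'max _ gQ); arith.
(* The sum o' + 2x exceeds o = o' + 2q, so it has the form o + 2g, whence g = x - q. *)
have shift x : x \in P `\ (0 : int) -> x - q \in Q `\ o.
  rewrite !in_fsetD1 => /andP[x0 xP].
  have xN := NP _ xP; have ev_x := Pev _ xP.
  case: (tightQ o' x o'Q (PA _ xP)); [arith|arith| |].
    by move=> /o_max; case: (Psmall _ xP); arith.
  move=> [g [gA go E]].
  have -> : x - q = g by arith.
  by rewrite go QE gA; arith.
(* The shift gives |P| <= |Q|, whereas [cP] and [cPQ] give |P| > |Q|. *)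
have : (#|` P `\ (0 : int)| <= #|` Q `\ o|)%N.
  rewrite -(card_image_int (fun x => x - q)); last by move=> x y; arith.
  by apply/fsubset_leq_card/fsubsetP => _ /imfsetP[x /= xP ->]; exact: shift.
by rewrite cP0; have := cardfsD1 o Q; rewrite oQ => c1 c2; exfalso; arith.
Qed.

End TightStructure.

(** * Counting all omission sums *)

Lemma omission_sum_even (A P : {fset int}) (x : int) :
  (forall a, a \in P -> (2 %| a)%Z) -> omission_sum A P x -> (2 %| x)%Z.
Proof. by move=> Pev [a [S [/Pev aP _ ->]]]; arith. Qed.

Lemma omission_sum_odd (A P : {fset int}) (x : int) :
  (forall a, a \in P -> ~~ (2 %| a)%Z) -> omission_sum A P x -> ~~ (2 %| x)%Z.
Proof. by move=> Podd [a [S [/Podd aP _ ->]]]; arith. Qed.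

Lemma omission_sumS (A P P' : {fset int}) (x : int) :
  P `<=` P' -> omission_sum A P x -> omission_sum A P' x.
Proof. by move=> /fsubsetP PP [a [S [/PP aP SA ->]]]; exists a, S. Qed.

Lemma fset_omit_max (A : {fset int}) (p : int) :
  (1 < #|` A|)%N ->
  exists2 M, M \in A `\ p & forall x, x \in A `\ p -> x <= M.
Proof.
move=> cA; apply: (fset_max id); rewrite -cardfs_gt0.
by have := cardfsD1 p A; case: (p \in A); arith.
Qed.

(** Together with [0 \in A], this is the exceptional set {0, q, 2q, 4q}. *)
Definition geometric4 (A : {fset int}) : Prop :=
  #|` A| = 4%N /\ exists q, [/\ 0 < q, q \in A, 2 * q \in A & 4 * q \in A].

(** A value a + 2 sum S has the parity of a, so the counts for even and odd omitted elements add
    up. *)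
Lemma omission_sums_odd (n : nat) (A : {fset int}) (b : int) :
  nonneg A -> 0 \in A -> (0 < n)%N -> #|` A| = n.+3 ->
  b \in A -> ~~ (2 %| b)%Z ->
  atleast (n.+2 * n.+2 + n.+2 + 1) (omission_sum A A) \/ geometric4 A.
Proof.
move=> nA A0 n0 cA bA bodd.
pose P := [fset x : int in A | (2 %| x)%Z]; pose Q := [fset x : int in A | ~~ (2 %| x)%Z].
have PE x : (x \in P) = (x \in A) && (2 %| x)%Z by rewrite !inE.
have QE x : (x \in Q) = (x \in A) && ~~ (2 %| x)%Z by rewrite !inE.
have PA : P `<=` A by apply/fsubsetP => x; rewrite PE => /andP[].
have QA : Q `<=` A by apply/fsubsetP => x; rewrite QE => /andP[].
have P0 : (0 : int) \in P by rewrite PE A0 dvdz0.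
have bQ : b \in Q by rewrite QE bA.
have cPQ : (#|` P| + #|` Q| = n.+3)%N.
  have <- : A `&` P = P by apply/fsetIidPr.
  have <- : A `\` P = Q.
    by apply/fsetP => x; rewrite in_fsetD PE QE; case: (x \in A); rewrite /= ?andbF ?andbT.
  by rewrite cardfsID.
have [o oQ omax] : exists2 x, x \in Q & forall y, y \in Q -> y <= x.
  by apply: (fset_max id); apply/fset0Pn; exists b.
have o0 : 0 < o.
  by move: (oQ); rewrite QE => /andP[/nA ? ?]; arith.
have [|N NA Nmax] := fset_omit_max A o; first by arith.
have [c cE [atQ tightQ]] :=
  omission_sum_bound _ _ _ _ _ nA A0 QA cA oQ omax o0 NA Nmax.
have join a1 a2 : (n.+2 * n.+2 + n.+2 + 1 <= a1 + a2)%N ->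
    atleast a1 (omission_sum A P) -> atleast a2 (omission_sum A Q) ->
    atleast (n.+2 * n.+2 + n.+2 + 1) (omission_sum A A).
  move=> le12 at1 at2; apply: atleast_imp le12 (fun x H => H) _.
  apply: (atleastU _ _ _ _ _ _ _ _ at1 at2) => x.
  - exact: omission_sumS.
  - exact: omission_sumS.
  - move=> xP xQ.
    have : ~~ (2 %| x)%Z by apply: omission_sum_odd xQ => a; rewrite QE => /andP[].
    suff -> : (2 %| x)%Z by [].
    by apply: omission_sum_even xP => a; rewrite PE => /andP[].
case: (leqP (n + 4) (2 * #|` P|)) => cP; last first.
  left.
  (* Omitting 0 gives at least (m^2 + m + 2)/2 even values; the odd chain adds m(m-1)/2 + 2r - 1,
     where 2r >= m + 1. *)
  have [g||c' c'E at0] := subset_sums n.+2 (A `\ (0 : int)).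
    by rewrite in_fsetD1 => /andP[g0 /nA]; arith.
    by have := cardfsD1 (0 : int) A; rewrite A0 cA; arith.
  apply: (join c' _ _ _ atQ); first by arith.
  apply: (atleast_inj _ (fun x => 2 * x)) at0; first by move=> x y; arith.
  by move=> x [S SA ->]; exists 0, S; split=> //; arith.
have [p pP pmax] : exists2 x, x \in P & forall y, y \in P -> y <= x.
  by apply: (fset_max id); apply/fset0Pn; exists 0.
have p0 : 0 < p.
  case: (ltP 0 p) => // p0.
  have : P `<=` [fset (0 : int)].
    apply/fsubsetP => x xP; rewrite inE.
    have xA := nA _ (fsubsetP PA _ xP); have xp := pmax _ xP; apply/eqP.
    by arith.
  by move/fsubset_leq_card; rewrite cardfs1; arith.
have [|M MA Mmax] := fset_omit_max A p; first by arith.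
have [d dE [atP tightP]] :=
  omission_sum_bound _ _ _ _ _ nA A0 PA cA pP pmax p0 MA Mmax.
(* The counts in [atP] and [atQ] add up to m^2 + m, so one further value in either class is
   enough. *)
case: tightQ => [atQ'|tightQ].
  by left; apply: (join _ _ _ atP atQ'); arith.
case: tightP => [atP'|tightP].
  by left; apply: (join _ _ _ atP' atQ); arith.
right.
have [||||n1 exq] := tight_structure n A P Q p M o N nA A0 n0 PE QE cPQ cP pP pmax oQ omax.
- by move=> x xA xp; apply: Mmax; rewrite in_fsetD1 xp.
- by move=> x xA xo; apply: Nmax; rewrite in_fsetD1 xo.
- move=> x y xP yA yx le; case: (tightP (x + 2 * y)) => //.
  - exact: omission_sum1.
  - by left.
  - by move=> [g]; rewrite in_fsetD1 => /andP[gp gA] E; right; exists g.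
- move=> x y xQ yA yx le; case: (tightQ (x + 2 * y)) => //.
  - exact: omission_sum1.
  - by left.
  - by move=> [g]; rewrite in_fsetD1 => /andP[gp gA] E; right; exists g.
by split=> //; rewrite cA n1.
Qed.

Lemma fsum_scale (S : {fset int}) (d : int) :
  d != 0 -> fsum ((fun x : int => d * x) @` S) = d * fsum S.
Proof.
move=> d0; rewrite /fsum big_imfset /=; first by rewrite mulr_sumr.
by move=> x y _ _; exact: mulfI.
Qed.

(** Omission sums scale with A, so a set of even numbers may be halved. The induction is on an upper
    bound [B] of A, which halving lowers by at least one. *)
Lemma omission_sums (n : nat) (A : {fset int}) :
  nonneg A -> 0 \in A -> (0 < n)%N -> #|` A| = n.+3 ->
  atleast (n.+2 * n.+2 + n.+2 + 1) (omission_sum A A) \/ geometric4 A.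
Proof.
move=> nA A0 n0.
have [B] : exists B : nat, forall a, a \in A -> a <= B%:Z.
  have [|b bA bmax] := fset_max id A; first by apply/fset0Pn; exists 0.
  by exists `|b|%N => a /bmax /=; have := nA _ bA; arith.
elim: B A nA A0 => [|B IH] A nA A0 AB cA.
  have : A `<=` [fset (0 : int)].
    apply/fsubsetP => x xA; rewrite inE; apply/eqP.
    by have := nA _ xA; have := AB _ xA; arith.
  by move/fsubset_leq_card; rewrite cardfs1 cA.
case: (Classical_Prop.classic (exists2 b, b \in A & ~~ (2 %| b)%Z)) => [[b bA bodd]|none].
  exact: omission_sums_odd bA bodd.
have Aev a : a \in A -> (2 %| a)%Z.
  by move=> aA; apply/negPn/negP => odd_a; apply: none; exists a.
pose A' : {fset int} := (fun x : int => (x %/ 2)%Z) @` A.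
have A'E x : (x \in A') = (2 * x \in A).
  apply/imfsetP/idP => [[y /= yA ->]|xA].
    by have := Aev _ yA => ev; have -> : 2 * (y %/ 2)%Z = y by arith.
  by exists (2 * x) => //=; arith.
have AE : A = (fun x : int => 2 * x) @` A'.
  apply/fsetP => y; apply/idP/imfsetP => [yA|[x /=]]; last by rewrite A'E => ? ->.
  have ev := Aev _ yA; have yE : y = 2 * (y %/ 2)%Z by arith.
  by exists (y %/ 2)%Z => //=; rewrite A'E -yE.
clearbody A'.
have cA' : #|` A'| = n.+3.
  by rewrite -cA AE card_image_int // => x y; arith.
case: (IH A') => //.
- by move=> x; rewrite A'E => /nA; arith.
- by rewrite A'E mulr0.
- move=> x; rewrite A'E => xA; have := AB _ xA; have := nA _ xA; arith.
- move=> at'; left; apply: (atleast_inj _ (fun x => 2 * x)) at'.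
    by move=> x y; arith.
  move=> x [a [S [aA SA ->]]].
  exists (2 * a), ((fun x : int => 2 * x) @` S); split.
  + by rewrite -A'E.
  + apply/fsubsetP => _ /imfsetP[y /= /(fsubsetP SA) yA ->].
    move: yA; rewrite !in_fsetD1 A'E => /andP[ya ->]; rewrite andbT.
    by apply: contraNneq ya => ?; apply/eqP; arith.
  + by rewrite fsum_scale //; arith.
move=> [c4 [q [q0 q1 q2 q4]]]; right; split; first by rewrite cA -cA' c4.
exists (2 * q); split; first by arith.
- by rewrite -A'E.
- by rewrite -A'E.
- have -> : 4 * (2 * q) = 2 * (4 * q) by arith.
  by rewrite -A'E.
Qed.

(** * Signed sums as differences of disjoint subset sums *)

(** [T] and [S] are the supports of the coefficients 1 and -1. *)
Definition signed_subset_sum (h : nat) (A : {fset int}) (x : int) : Prop :=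
  exists T S, [/\ T `<=` A, S `<=` A, [disjoint T & S],
                  (#|` T| + #|` S| = h)%N & x = fsum T - fsum S].

Lemma signed_subset_sumN (h : nat) (A : {fset int}) (x : int) :
  signed_subset_sum h A x -> signed_subset_sum h A (- x).
Proof.
move=> [T [S [TA SA dTS cTS ->]]]; exists S, T; split=> //; [|arith|arith].
by rewrite fdisjoint_sym.
Qed.

Lemma signed_subset_sumS (h : nat) (A B : {fset int}) (x : int) :
  A `<=` B -> signed_subset_sum h A x -> signed_subset_sum h B x.
Proof.
move=> AB [T [S [TA SA dTS cTS ->]]]; exists T, S; split=> //.
  exact: fsubset_trans AB.
exact: fsubset_trans AB.
Qed.

Lemma signed_subset_sum_fset (T A : {fset int}) :
  T `<=` A -> signed_subset_sum #|` T| A (fsum T).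
Proof.
move=> TA; exists T, fset0; rewrite fsub0set fsum0 cardfs0 fdisjointX0.
by split=> //; arith.
Qed.

Lemma signed_subset_sum_symm (n h : nat) (A : {fset int}) :
  atleast n (fun x => signed_subset_sum h A x /\ 0 < x) ->
  atleast (2 * n) (signed_subset_sum h A).
Proof.
move=> atn; rewrite mul2n -addnn.
apply: (atleastU n n _ (fun x => signed_subset_sum h A x /\ x < 0) _ _ _ _ atn).
- by move=> x [].
- by move=> x [].
- by move=> x [_ ?] [_ ?]; arith.
apply: (atleast_inj _ (fun x => - x)) atn; first by move=> x y; arith.
by move=> x [Xx x0]; split; [exact: signed_subset_sumN|arith].
Qed.

Lemma in_restricted_signed_sumset (h : nat) (A : {fset int}) (x : int) :
  signed_subset_sum h A x -> x \in restricted_signed_sumset h A.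
Proof.
move=> [T [S [TA SA dTS cTS ->]]]; apply/restricted_signed_sumsetP.
have s1 : 1 \in signs by rewrite !inE.
have s0 : 0 \in signs by rewrite !inE.
have sN : -1 \in signs by rewrite !inE.
pose l (x : int) : signs :=
  if x \in T then [` s1] else if x \in S then [` sN] else [` s0].
have ST y : y \in S -> y \notin T by rewrite fdisjoint_sym in dTS; apply/fdisjointP.
(* Used twice: with the absolute value of the coefficient for the weight, and with the product for
   the sum. *)
have lE (g : int -> int -> int) : (forall a, g 0 a = 0) ->
    \sum_(a : A) g (val (l (val a))) (val a) =
    \sum_(a <- T) g 1 a + \sum_(a <- S) g (- 1) a.
  move=> g0; rewrite -(big_seq_fsetE _ A predT (fun a => g (val (l a)) a)) /=.
  have -> : A = (T `|` S) `|` (A `\` (T `|` S)).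
    by rewrite fsetUDl fsetDv fsetD0; apply/esym/fsetUidPr; rewrite fsubUset TA.
  rewrite sum_fsetU /=; last by apply/fdisjointP => y yTS; rewrite in_fsetD yTS.
  rewrite sum_fsetU //=.
  have -> : \sum_(a <- A `\` (T `|` S)) g (val (l a)) a = 0.
    apply: big1_fset => y; rewrite in_fsetD in_fsetU negb_or => /andP[/andP[yT yS] _] _.
    by rewrite /l (negbTE yT) (negbTE yS) /= g0.
  rewrite addr0.
  congr (_ + _); apply: eq_big_seq => y yin; rewrite /l ?yin //.
  by rewrite (negbTE (ST _ yin)).
exists [ffun a => l (val a)]; split.
  under eq_bigr => a _ do rewrite ffunE.
  rewrite (lE (fun z _ => `|z|)) //.
  by rewrite !big_const_seq !count_predT !iter_addr_0; arith.
under eq_bigr => a _ do rewrite ffunE.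
rewrite (lE (fun z a => z * a)); last by move=> a; rewrite mul0r.
rewrite /fsum; congr (_ + _); first by apply: eq_bigr => a _; rewrite mul1r.
by rewrite -sumrN; apply: eq_bigr => a _; rewrite mulN1r.
Qed.

(** Every element but a carries a sign, and making those in S negative lowers fsum (A \ a) by 2 fsum
    S. *)
Lemma signed_subset_sum_omission (h : nat) (A : {fset int}) (y : int) :
  #|` A| = h.+1 -> omission_sum A A y -> signed_subset_sum h A (fsum A - y).
Proof.
move=> cA [a [S [aA SA ->]]].
have sA : A `\ a `<=` A by exact: fsubD1set.
have dS : [disjoint S & (A `\ a) `\` S] by apply/fdisjointP => x xS; rewrite in_fsetD xS.
have AS : A `\ a = S `|` ((A `\ a) `\` S).
  by rewrite fsetUDl fsetDv fsetD0; apply/esym/fsetUidPr.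
exists ((A `\ a) `\` S), S; split.
- by apply: fsubset_trans sA; exact: fsubsetDl.
- exact: fsubset_trans sA.
- by rewrite fdisjoint_sym.
- have := cardfsD1 a A; rewrite aA cA {1}AS.
  have := cardfsUI S ((A `\ a) `\` S).
  by move: dS; rewrite -fsetI_eq0 => /eqP->; rewrite cardfs0; arith.
- by rewrite (fsumD1 A a aA) {1}AS fsumU //; arith.
Qed.

Lemma exists_subset (h : nat) (A : {fset int}) :
  (h <= #|` A|)%N -> exists2 T, T `<=` A & #|` T| = h.
Proof.
elim: h => [|h IH] hA; first by exists fset0; rewrite ?fsub0set ?cardfs0.
have [|T TA cT] := IH; first by arith.
have /fset0Pn[x] : A `\` T != fset0.
  by rewrite -cardfs_gt0 cardfsD (fsetIidPr TA) cT; arith.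
rewrite in_fsetD => /andP[xT xA]; exists (x |` T).
  by rewrite fsubUset fsub1set xA.
by rewrite cardfsU1 xT cT.
Qed.

Lemma exists_max_subset (h : nat) (A : {fset int}) :
  (h <= #|` A|)%N ->
  exists T, [/\ T `<=` A, #|` T| = h &
    forall S, S `<=` A -> #|` S| = h -> fsum S <= fsum T].
Proof.
move=> hA.
pose F := [fset S in fpowerset A | #|` S| == h].
have FE S : (S \in F) = (S `<=` A) && (#|` S| == h).
  by rewrite !inE fpowersetE.
have [|T TF Tmax] := fset_max fsum F.
  by have [T TA cT] := exists_subset _ _ hA; apply/fset0Pn; exists T; rewrite FE TA cT eqxx.
move: TF; rewrite FE => /andP[TA /eqP cT]; exists T; split=> // S SA cS.
by apply: Tmax; rewrite FE SA cS eqxx.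
Qed.

Lemma signed_subset_sum_add_max (n h : nat) (A : {fset int}) (b : int) :
  nonneg A -> b \in A -> (forall a, a \in A `\ b -> a < b) ->
  (h <= #|` A `\ b|)%N ->
  atleast n (signed_subset_sum h (A `\ b)) ->
  atleast (n + 2 * h) (signed_subset_sum h A).
Proof.
move=> nA bA bmax hA atn.
have sA : A `\ b `<=` A by exact: fsubD1set.
have nA' := nonnegS _ _ sA nA.
have [T [TA cT Tmax]] := exists_max_subset h (A `\ b) hA.
have nT := nonnegS _ _ TA nA'.
have T0 := fsum_ge0 _ nT.
(* Making all signs positive does not decrease the sum, and it yields the sum of an h-subset. *)
have le_max x : signed_subset_sum h (A `\ b) x -> x <= fsum T.
  move=> [U [S [UA SA dUS cUS ->]]].
  have := fsum_ge0 _ (nonnegS _ _ SA nA').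
  have : fsum (U `|` S) <= fsum T.
    apply: Tmax; first by rewrite fsubUset UA.
    have := cardfsUI U S; move: dUS; rewrite -fsetI_eq0 => /eqP->.
    by rewrite cardfs0; arith.
  by rewrite fsumU //; arith.
(* In [T], one element t is exchanged for the larger b. *)
have at_top : atleast h (fun x => signed_subset_sum h A x /\ fsum T < x).
  rewrite -{1}cT; apply: (atleast_image T (fun t => b + fsum T - t)).
    by move=> x y; arith.
  move=> t tT; have tb := bmax _ (fsubsetP TA _ tT).
  split; last by arith.
  have bT : b \notin T `\ t.
    by apply/negP; rewrite in_fsetD1 => /andP[_ /(fsubsetP TA)]; rewrite !inE eqxx.
  have -> : h = #|` b |` (T `\ t)|.
    by rewrite cardfsU1 bT; have := cardfsD1 t T; rewrite tT cT; arith.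
  have -> : b + fsum T - t = fsum (b |` (T `\ t)).
    by rewrite fsumU1 // (fsumD1 T t tT); arith.
  apply: signed_subset_sum_fset; rewrite fsubUset fsub1set bA.
  by apply: fsubset_trans (fsubD1set _ _) (fsubset_trans TA sA).
have at_bot : atleast h (fun x => signed_subset_sum h A x /\ x < - fsum T).
  apply: (atleast_inj _ (fun x => - x)) at_top; first by move=> x y; arith.
  by move=> x [Xx xT]; split; [exact: signed_subset_sumN|arith].
have -> : (n + 2 * h = n + h + h)%N by arith.
have ge_min x : signed_subset_sum h (A `\ b) x -> - fsum T <= x.
  by move=> /signed_subset_sumN/le_max; arith.
pose Y x := signed_subset_sum h A x /\ - fsum T <= x.
have at_mid : atleast (n + h) Y.
  apply: (atleastU _ _ _ _ _ _ _ _ atn at_top) => x.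
  - by move=> Xx; split; [exact: signed_subset_sumS Xx|exact: ge_min].
  - by move=> [Xx ?]; split=> //; arith.
  - by move=> /le_max ? [_ ?]; arith.
apply: (atleastU _ _ _ _ _ _ _ _ at_mid at_bot) => x.
- by move=> [].
- by move=> [].
- by move=> [_ ?] [_ ?]; arith.
Qed.

(** * Explicit sums for the exceptional set, and the lower bound *)

Lemma signed_sum3 (A : {fset int}) (a b c : int) :
  a \in A -> b \in A -> c \in A -> a != b -> a != c -> b != c ->
  signed_subset_sum 3 A (a + b + c) /\ signed_subset_sum 3 A (a + b - c).
Proof.
move=> aA bA cA ab ac bc.
have abA : [fset a; b] `<=` A by rewrite fsubUset !fsub1set aA.
have cab : c \notin [fset a; b].
  by rewrite !inE negb_or eq_sym ac eq_sym bc.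
have sab : fsum [fset a; b] = a + b by rewrite fsumU1 ?fsum1 // inE.
split.
  have -> : a + b + c = fsum (c |` [fset a; b]).
    by rewrite fsumU1 // sab addrC.
  have -> : 3%N = #|` c |` [fset a; b]| by rewrite cardfsU1 cab cardfs2 ab.
  by apply: signed_subset_sum_fset; rewrite fsubUset fsub1set cA.
exists [fset a; b], [fset c]; split=> //.
- by rewrite fsub1set.
- by rewrite fdisjoint_sym; apply/fdisjointP => x; rewrite inE => /eqP->.
- by rewrite cardfs2 cardfs1 ab.
- by rewrite sab fsum1.
Qed.

Lemma atleast_sorted (s : seq int) (X : int -> Prop) :
  sorted <%R s -> (forall x, x \in s -> X x) -> atleast (size s) X.
Proof.
move=> /(sorted_uniq lt_trans (@ltxx _ _)) us sX.
exists [fset x : int in s]; first by rewrite card_fseq undup_id.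
by move=> x; rewrite inE; exact: sX.
Qed.

Lemma signed_subset_sum_geometric (A : {fset int}) (q b : int) :
  0 < q -> 0 \in A -> q \in A -> 2 * q \in A -> 4 * q \in A ->
  b \in A -> 4 * q < b -> atleast 20 (signed_subset_sum 3 A).
Proof.
move=> q0 A0 A1 A2 A4 bA qb; apply: (signed_subset_sum_symm 10).
(* Ten positive values, increasing because b > 4q puts b + 3q above 7q; negation doubles their
   number. *)
pose s := [:: q; 2 * q; 3 * q; 5 * q; 6 * q; 7 * q;
              b + 3 * q; b + 4 * q; b + 5 * q; b + 6 * q].
apply: (atleast_sorted s); first by rewrite /= /s /=; arith.
have S x y z := signed_sum3 A x y z.
have [s012 _] := S 0 q (2 * q) A0 A1 A2 ltac:(arith) ltac:(arith) ltac:(arith).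
have [s7 _] := S q (2 * q) (4 * q) A1 A2 A4 ltac:(arith) ltac:(arith) ltac:(arith).
have [_ s5] := S (2 * q) (4 * q) q A2 A4 A1 ltac:(arith) ltac:(arith) ltac:(arith).
have [_ s3] := S q (4 * q) (2 * q) A1 A4 A2 ltac:(arith) ltac:(arith) ltac:(arith).
have [_ s1] := S q (2 * q) (4 * q) A1 A2 A4 ltac:(arith) ltac:(arith) ltac:(arith).
have [s6 _] := S 0 (2 * q) (4 * q) A0 A2 A4 ltac:(arith) ltac:(arith) ltac:(arith).
have [_ s2] := S 0 (4 * q) (2 * q) A0 A4 A2 ltac:(arith) ltac:(arith) ltac:(arith).
have [t3 _] := S b q (2 * q) bA A1 A2 ltac:(arith) ltac:(arith) ltac:(arith).
have [t4 _] := S b 0 (4 * q) bA A0 A4 ltac:(arith) ltac:(arith) ltac:(arith).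
have [t5 _] := S b q (4 * q) bA A1 A4 ltac:(arith) ltac:(arith) ltac:(arith).
have [t6 _] := S b (2 * q) (4 * q) bA A2 A4 ltac:(arith) ltac:(arith) ltac:(arith).
(* The sum q + 2q - 4q is -q, so its opposite is taken. *)
move/signed_subset_sumN: s1 => s1.
have E x y : signed_subset_sum 3 A x -> x = y -> 0 < y ->
    signed_subset_sum 3 A y /\ 0 < y by move=> ? <-.
move=> x; rewrite !inE => /or4P[/eqP->|/eqP->|/eqP->|].
- by apply: E s1 _ _; arith.
- by apply: E s2 _ _; arith.
- by apply: E s3 _ _; arith.
move=> /or4P[/eqP->|/eqP->|/eqP->|].
- by apply: E s5 _ _; arith.
- by apply: E s6 _ _; arith.
- by apply: E s7 _ _; arith.
move=> /or4P[/eqP->|/eqP->|/eqP->|/eqP->].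
- by apply: E t3 _ _; arith.
- by apply: E t4 _ _; arith.
- by apply: E t5 _ _; arith.
- by apply: E t6 _ _; arith.
Qed.

(** Induction on k from k = h + 1, where h^2 + h + 1 omission sums suffice; each new maximum adds
    the required 2h. The exceptional set has four elements, so it interferes only in the step to k =
    5. *)
Lemma signed_subset_sum_lower (k h : nat) (A : {fset int}) :
  nonneg A -> 0 \in A -> (3 <= h)%N -> (h < k)%N -> #|` A| = k ->
  (exists2 n : nat, (n + h * h + h = 2 * h * k + 1)%N &
    atleast n (signed_subset_sum h A)) \/ h = 3%N /\ geometric4 A.
Proof.
elim: k A => [//|k IH] A nA A0 h3 hk cA.
case: (eqVneq h k) => [hkE|hkn].
  have [||at1|geo] := omission_sums (h - 2) A nA A0.
  - by arith.
  - by rewrite cA; arith.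
  - have {}at1 : atleast (h * h + h + 1) (omission_sum A A).
      by apply: atleast_imp at1 => //; have -> : (h - 2).+2 = h by arith.
    left; exists (h * h + h + 1)%N; first by rewrite -hkE; arith.
    have cA' : #|` A| = h.+1 by rewrite cA hkE.
    apply: (atleast_inj _ (fun y => fsum A - y)) at1; last first.
    + by move=> y; exact: signed_subset_sum_omission.
    + by move=> x y; arith.
  - by right; split=> //; case: geo; rewrite cA -hkE => -[].
have {}hk : (h < k)%N by arith.
have [|b bA bmax] := fset_max id A; first by apply/fset0Pn; exists 0.
have cA' : #|` A `\ b| = k by have := cardfsD1 b A; rewrite bA cA; arith.
have b_gt a : a \in A `\ b -> a < b.
  by rewrite in_fsetD1 => /andP[ab /bmax /=]; arith.
have A'0 : 0 \in A `\ b.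
  rewrite in_fsetD1 A0 andbT; apply/eqP => b0.
  have : A `<=` [fset (0 : int)].
    apply/fsubsetP => x xA; rewrite inE; apply/eqP.
    by have := nA _ xA; have := bmax _ xA; arith.
  by move/fsubset_leq_card; rewrite cardfs1; arith.
have nA' : nonneg (A `\ b) by apply: nonnegS nA; exact: fsubD1set.
left; case: (IH (A `\ b)) => //.
  move=> [n nE atn]; exists (n + 2 * h)%N; first by nia.
  by apply: signed_subset_sum_add_max atn => //; arith.
move=> [hE [c4 [q [q0 q1 q2 q4]]]].
(* For h = 3 and k = 5 the bound is 30 - 12 + 1 = 19. *)
exists 19%N; first by move: c4; rewrite cA'; arith.
have sub x : x \in A `\ b -> x \in A by rewrite in_fsetD1 => /andP[].
rewrite hE; apply: (atleast_imp 20 19 (signed_subset_sum 3 A)) => //.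
by apply: (signed_subset_sum_geometric A q b) => //; [exact: sub..|exact: b_gt].
Qed.

(** * Sharpness for {0, ..., k-1}, and the conclusion *)

(** The right side is twice (k - h) + ... + (k - 1), the sum of the h largest indices; integer
    weights in [0, 1] are 0 or 1, and the last one is split off. *)
Lemma weighted_sum_bound (w : nat -> int) (h k : nat) :
  (forall i, 0 <= w i <= 1) -> \sum_(0 <= i < k) w i = h%:Z ->
  2 * (\sum_(0 <= i < k) w i * i%:Z) <= 2 * h%:Z * k%:Z - h%:Z * (h%:Z + 1).
Proof.
move=> w01; elim: k h => [|k IH] h.
  by rewrite !big_nil => h0; have -> : h = 0%N by arith.
rewrite !big_nat_recr //= => sw.
have [w0|w1] : w k = 0 \/ w k = 1 by have := w01 k; arith.
  move: sw; rewrite w0 addr0 mul0r addr0 => /IH.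
  by move=> H; apply: (le_trans H); nia.
case: h sw => [|h] sw.
  have : 1 <= \sum_(0 <= i < k) w i + w k.
    by rewrite w1 lerDr; apply: sumr_ge0 => i _; case/andP: (w01 i).
  by rewrite sw.
have /IH : \sum_(0 <= i < k) w i = h%:Z.
  by move: sw; rewrite w1 intS addrC => /addrI.
move=> H; rewrite w1 mul1r [leLHS]mulrDr; apply: (le_trans (lerD H (lexx _))).
by nia.
Qed.

(** The elements lie between -M and M with M the integer part of B/2, and 2M + 1 <= B + 1. Doubling
    keeps h(h + 1) unhalved. *)
Lemma card_interval (F : {fset int}) (B : int) :
  0 <= B -> (forall x, x \in F -> 2 * `|x| <= B) -> (#|` F|)%:Z <= B + 1.
Proof.
move=> B0 FB; pose M : int := (B %/ 2)%Z.
pose s := [seq i%:Z - M | i <- iota 0 (2 * `|M| + 1)].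
have : (#|` F| <= size s)%N.
  apply: uniq_leq_size; first exact: fset_uniq.
  move=> x /FB xB; apply/mapP; exists (absz (x + M)); last by rewrite /M; arith.
  by rewrite mem_iota /M; arith.
by rewrite size_map size_iota /M; arith.
Qed.

Lemma signed_sumset_interval (h k : nat) :
  exists A : {fset int}, nonneg_set_from_zero k A /\
    forall x, x \in restricted_signed_sumset h A ->
      2 * `|x| <= 2 * h%:Z * k%:Z - h%:Z * (h%:Z + 1).
Proof.
pose a (i : 'I_k) : int := (i : nat)%:Z.
pose A : {fset int} := [fset a i | i : 'I_k].
exists A; split; first by exists a; split=> // i; rewrite /a; lia.
move=> x /restricted_signed_sumsetP[lam [lamh ->]].
(* The coefficients are extended by 0 outside A, so that sums over A become sums over indices below
   k. *)
pose l (b : int) : int := oapp (fun b' : A => val (lam b')) 0 (insub b).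
have lE (b : A) : val (lam b) = l (val b) by rewrite /l valK.
have l01 b : 0 <= `|l b| <= 1.
  rewrite normr_ge0 /l; case: insubP => [b' _ _|] //=.
  by have := valP (lam b'); rewrite !inE => /orP[/orP[]|] /eqP->.
have sumE (F : int -> int) : \sum_(b : A) F (val b) = \sum_(0 <= i < k) F i%:Z.
  rewrite -(big_seq_fsetE _ A predT) /=.
  rewrite (perm_big [seq i%:Z | i <- index_iota 0 k]) ?big_map //=.
  apply: uniq_perm; first exact: fset_uniq.
    by rewrite map_inj_uniq ?iota_uniq // => i j [].
  move=> y; apply/imfsetP/mapP => [[i _ ->]|[i]].
    by exists (i : nat) => //; rewrite mem_index_iota /=.
  by rewrite mem_index_iota => /andP[_ ik] ->; exists (Ordinal ik).
have : \sum_(0 <= i < k) `|l i%:Z| = h%:Z.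
  by rewrite -lamh -(sumE (fun b => `|l b|)); apply: eq_bigr => b _; rewrite lE.
(* The weights are the absolute values of the coefficients; the triangle inequality remains. *)
move=> /(weighted_sum_bound _ _ _ (fun i => l01 i%:Z)); apply: le_trans.
rewrite ler_pM2l //.
have -> : \sum_(b : A) val (lam b) * val b = \sum_(0 <= i < k) l i%:Z * i%:Z.
  by rewrite -(sumE (fun b => l b * b)); apply: eq_bigr => b _; rewrite lE.
apply: le_trans (ler_norm_sum _ _ _) _.
by apply: ler_sum => i _; rewrite normrM.
Qed.

Theorem theorem1p1 (h k : nat) (h_pos : (0 < h)%N) (k_pos : (0 < k)%N)
    (h_range : (3 <= h <= k - 1)%N) (k_ge5 : (5 <= k)%N) :
  (forall A : {fset int}, nonneg_set_from_zero k A ->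
     2 * h%:Z * k%:Z - h%:Z * (h%:Z + 1) + 1
       <= (#|` restricted_signed_sumset h A|)%:Z)
  /\ (exists A : {fset int}, nonneg_set_from_zero k A /\
        (#|` restricted_signed_sumset h A|)%:Z
          = 2 * h%:Z * k%:Z - h%:Z * (h%:Z + 1) + 1).
Proof.
have lower (A : {fset int}) : nonneg_set_from_zero k A ->
    2 * h%:Z * k%:Z - h%:Z * (h%:Z + 1) + 1
      <= (#|` restricted_signed_sumset h A|)%:Z.
  move=> [a [AE a_ge0 a_0 a_lt]].
  have nA : nonneg A by move=> x; rewrite AE => /imfsetP[i _ ->].
  have A0 : 0 \in A.
    by rewrite AE; apply/imfsetP; exists (Ordinal k_pos) => //; rewrite a_0.
  have a_inj : injective a.
    move=> i j aij; apply/val_inj; case: (ltngtP i j) => // /a_lt;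
    by rewrite aij ltxx.
  have cA : #|` A| = k by rewrite AE card_imfset //= -cardE card_ord.
  (* The exceptional alternative would make k = 4, against [k_ge5]. *)
  have [||[n nE [F cF FX]]|[_ [c4 _]]] := signed_subset_sum_lower k h A nA A0 _ _ cA.
  - by arith.
  - by arith.
  - have : (#|` F| <= #|` restricted_signed_sumset h A|)%N.
      apply/fsubset_leq_card/fsubsetP => x /FX.
      exact: in_restricted_signed_sumset.
    by arith.
  - by arith.
split=> //; have [A [HA Abound]] := signed_sumset_interval h k.
exists A; split=> //; apply/eqP; rewrite eq_le lower // andbT.
apply: card_interval => //.
by nia.
Qed.
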